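(* Let $m\ge 3$ be an integer. For every integer $n\ge m^2$, $$b_{\mathbf{t}_m,2}(n)=\begin{cases} b_{\mathbf{t}_m,1}(n/m)+m(m-1)\bigl(m(m-1)+1\bigr), & \text{if } n\equiv 0 \pmod m;\\ m^4-2m^3+2m^2, & \text{otherwise,}\end{cases}$$ where $b_{\mathbf{t}_m,1}$ is the abelian complexity function of $\mathbf{t}_m$ (whose explicit value for arguments at least $m$ is recalled in the context).
   Context: Let $\Sigma_m=\{0,1,\dots,m-1\}$ and let $\Sigma_m^*$ be the set of finite words over $\Sigma_m$. The morphism $\sigma_m:\Sigma_m^*\to\Sigma_m^*$ is defined on letters by $\sigma_m(a)=a(a+1)\cdots(a+m-1)$, each letter reduced modulo $m$ to an element of $\Sigma_m$. The generalized Thue-Morse word $\mathbf{t}_m=\sigma_m^\infty(0)$ is the infinite fixed point of $\sigma_m$ beginning with $0$. For $n\ge1$, $\mathcal{F}_{\mathbf{t}_m}(n)$ is the set of factors (blocks of consecutive letters) of $\mathbf{t}_m$ of length $n$. For finite words $u,x$, $\binom{u}{x}$ is the number of occurrences of $x$ as a (not necessarily contiguous) subsequence of $u$. For $k\ge1$, $u\sim_k v$ means $\binom{u}{x}=\binom{v}{x}$ for all words $x\in\Sigma_m^*$ of length at most $k$. The $k$-binomial complexity is $b_{\mathbf{t}_m,k}(n)=\#(\mathcal{F}_{\mathbf{t}_m}(n)/\!\sim_k)$, the number of $\sim_k$-classes of factors of length $n$; for $k=1$ this is the abelian complexity. Known value of the abelian complexity (a previously published result recalled by the paper): for every integer $n\ge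 m$ with $n\equiv r\pmod m$, $0\le r\le m-1$, $$b_{\mathbf{t}_m,1}(n)=\begin{cases}\frac14 m(m^2-1)+1, & m\text{ odd},\ r=0;\\ \frac14 m(m-1)^2+m, & m\text{ odd},\ r\ne0;\\ \frac14 m^3+1, & m\text{ even},\ r=0;\\ \frac14 m(m-1)^2+\frac54 m, & m\text{ even},\ r\neq0\text{ even};\\ \frac14 m^2(m-2)+m, & m\text{ even},\ r\text{ odd}.\end{cases}$$ *)

(* Defs.v *)
From HB Require Import structures.
From mathcomp Require Import all_boot all_order all_algebra.
From mathcomp Require Import boolp.

Set Implicit Arguments.
Unset Strict Implicit.
Unset Printing Implicit Defensive.

Import GRing.Theory.

(* The alphabet {0, .., m-1} is ['Z_m], which has exactly m elements only when
   1 < m; letters are then added modulo m. *)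
Definition sigma (m : nat) (w : seq 'Z_m) : seq 'Z_m :=
  flatten [seq [seq (a + i%:R)%R | i <- iota 0 m] | a <- w].

(* The i-th letter of the limit of the words [iter k (sigma m) [:: 0]]. For
   1 < m these are prefixes of one another, and the one with k = i has length
   m ^ i > i, so the default value of [nth] is not used. *)
Definition thue_morse (m : nat) (i : nat) : 'Z_m :=
  nth 0%R (iter i (@sigma m) [:: 0%R]) i.

Definition factors (T : finType) (s : nat -> T) (n : nat) : {set n.-tuple T} :=
  [set w : n.-tuple T |
     `[< exists i : nat, tval w = [seq s (i + j) | j <- iota 0 n] >]].

(* An occurrence of x as a subsequence of u is a selection of positions of u,
   given by a bit mask of length [size u], whose letters read x. *)
Definition subword_binomial (T : finType) (u x : seq T) : nat :=
  #|[set b : (size u).-tuple bool | mask b u == x]|.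

Definition binomial_equiv (T : finType) (k : nat) (u v : seq T) : bool :=
  [forall l : 'I_k.+1, forall x : l.-tuple T,
     subword_binomial u x == subword_binomial v x].

Definition binomial_complexity (T : finType) (s : nat -> T) (k n : nat) : nat :=
  #|equivalence_partition (fun u v : n.-tuple T => binomial_equiv k u v)
      (factors s n)|.

Definition abelian_complexity (T : finType) (s : nat -> T) (n : nat) : nat :=
  binomial_complexity s 1 n.

Lemma binomial_equivP (T : finType) (k : nat) (u v : seq T) :
  reflect (forall x : seq T, size x <= k ->
             subword_binomial u x = subword_binomial v x)
          (binomial_equiv k u v).
Proof.
apply: (iffP forallP) => [H x xk | H l].
  have := H (Ordinal (xk : size x < k.+1)).
  by move=> /forallP /(_ (in_tuple x)) /eqP.
by apply/forallP => x; apply/eqP/H; rewrite size_tuple -ltnS ltn_ord.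
Qed.

Lemma binomial_equiv_equivalence (T : finType) (k : nat) :
  equivalence_rel (@binomial_equiv T k).
Proof.
move=> u v w; split=> [|/binomial_equivP uv]; first exact/binomial_equivP.
by apply/binomial_equivP/binomial_equivP => H x xk; rewrite ?uv ?H -?uv ?H.
Qed.

Lemma size_sigma (m : nat) (w : seq 'Z_m) : size (sigma w) = m * size w.
Proof.
elim: w => [|a w IHw]; first by rewrite muln0.
by rewrite /sigma /= size_cat size_map size_iota -/(sigma w) IHw mulnS.
Qed.

Lemma sigma_cat (m : nat) (u v : seq 'Z_m) :
  sigma (u ++ v) = sigma u ++ sigma v.
Proof. by rewrite /sigma map_cat flatten_cat. Qed.

Lemma size_iter_sigma (m k : nat) :
  size (iter k (@sigma m) [:: 0%R]) = m ^ k.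
Proof. by elim: k => //= k IHk; rewrite size_sigma IHk expnS. Qed.

Lemma prefix_iter_sigma (m k l : nat) : 1 < m -> k <= l ->
  prefix (iter k (@sigma m) [:: 0%R]) (iter l (@sigma m) [:: 0%R]).
Proof.
move=> m1 /subnK <-; elim: (l - k) => [|d IHd]; first exact: prefix_refl.
apply: prefix_trans IHd _; rewrite addSn; elim: (d + k) => [|j IHj].
  by case: m m1 => [|m] // _; exact: prefix0s.
rewrite [X in prefix X _]iterS [X in prefix _ X]iterS.
by case/prefixP: IHj => s ->; rewrite sigma_cat prefix_prefix.
Qed.

Lemma iter_sigmaE (m k : nat) : 1 < m ->
  iter k (@sigma m) [:: 0%R] = mkseq (thue_morse m) (m ^ k).
Proof.
move=> m1; apply: (@eq_from_nth _ 0%R); rewrite size_iter_sigma ?size_mkseq //.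
move=> i ik; rewrite nth_mkseq // /thue_morse.
have ii : i < m ^ i by apply: ltn_expl.
have [kl|/ltnW lk] := leqP k i.
  have /prefixP[s ->] := prefix_iter_sigma m1 kl.
  by rewrite nth_cat size_iter_sigma ik.
have /prefixP[s ->] := prefix_iter_sigma m1 lk.
by rewrite nth_cat size_iter_sigma ii.
Qed.

Lemma sigma_thue_morse (m n : nat) : 1 < m ->
  sigma (mkseq (thue_morse m) n) = mkseq (thue_morse m) (m * n).
Proof.
move=> m1; have nk : n <= m ^ n by apply/ltnW/ltn_expl.
have E : sigma (mkseq (thue_morse m) (m ^ n)) = mkseq (thue_morse m) (m ^ n.+1).
  by rewrite -!iter_sigmaE.
have split_mkseq p q : p <= q ->
    mkseq (thue_morse m) p = take p (mkseq (thue_morse m) q).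
  by move=> pq; rewrite /mkseq -map_take take_iota; move/minn_idPl: pq => ->.
rewrite (split_mkseq (m * n) (m ^ n.+1)); last by rewrite expnS leq_mul2l nk orbT.
rewrite -E -(cat_take_drop n (mkseq (thue_morse m) (m ^ n))) sigma_cat.
rewrite -split_mkseq // take_size_cat //.
by rewrite size_sigma size_mkseq.
Qed.

(* Main.v *)
Require Import Defs.
From mathcomp Require Import all_boot all_order all_algebra zify ring.
From mathcomp Require Import boolp.

(** A factor of length n starting at P is [run ++ sigma w ++ run]: a proper
    suffix of a block, K whole blocks, and a proper prefix of a block, where w
    is itself a factor of length K and each of the two runs consists of fewer
    than m consecutive letters. Write p and s for the indicator functions of
    the letters of the two runs.

    Rigidity. A block of [sigma] is a permutation of the alphabet, so the
    2-binomial class of [sigma w] depends on w only through its letter counts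
    ([pairs_sigma]). Conversely the class of the factor determines both runs
    and the letter counts of w. It suffices to know |u|_x = K + p x + s x and
    the number of occurrences of x (x-1), which is
       |w|_x + C(K,2) + K p x + K s (x-1) + p x s (x-1),
    because a block contains x before x-1 only when it starts with x. If two
    equivalent factors had different functions p or different numbers of blocks,
    then p - p' would not be constant on the cyclic alphabet, and at a place
    where it varies the terms with factor K could only be compensated if w or w'
    were a power of a single letter. As K >= m-1 and the word has no
    cubes, this leaves m = 3 and K = 2, where the letters around a square xx are
    known and the counts still disagree ([tame_eq_sizes], [tame_le_size],
    [blocks_equivP]).

    Counting. By rigidity the residue r of P modulo m is an invariant, and for
    fixed r the classes are counted by the pairs or triples consisting of the
    letter counts of a window t[q, q+l) and of one or both of the letters
    a = t q, b = t (q+l). Up to a constant these counts are known from their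
    cyclic differences
       [x = a] - [x = a - q] + [x = b - q - l] - [x = b]
    ([window_differences]), while a, b and q mod m can be prescribed freely
    once l >= m ([thue_morse_pair_mod]). With both letters recorded, q mod m is
    recovered exactly when b - l <> a, which gives m (m (m-1) + 1) classes
    ([num_classes_both_ends]). With one letter recorded, two of the remaining
    terms can be exchanged, so that pairs of residues are replaced by unordered
    pairs, and m (C(m,2) + 1) classes are left ([num_classes_left_end],
    [num_classes_right_end]). When r = 0 and m divides n no letter is recorded
    and the abelian complexity at n / m appears. Summing over r gives the
    formula. *)

Set Implicit Arguments.
Unset Strict Implicit.
Unset Printing Implicit Defensive.

Import GRing.Theory.

(** * Binomial coefficients of words of length at most two *)

Lemma card_set_cons (n : nat) (P : pred (seq bool)) :
  #|[set b : n.+1.-tuple bool | P b]| =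
  #|[set b : n.-tuple bool | P (true :: b)]|
  + #|[set b : n.-tuple bool | P (false :: b)]|.
Proof.
pose c x (b : n.-tuple bool) := cons_tuple x b.
have c_inj x : injective (c x).
  by move=> b b' /(congr1 val) [] E; apply: val_inj.
rewrite -(card_imset _ (c_inj true)) -(card_imset _ (c_inj false)) -cardsUI.
set U := _ :|: _; set V := _ :&: _; have -> : V = set0.
  apply/setP=> b; rewrite !inE; apply/negP => /andP[] /imsetP[b1 _ ->].
  by case/imsetP => b2 _ /(congr1 val).
rewrite cards0 addn0 /U {U V}.
apply: eq_card => b; rewrite !inE; apply/idP/orP.
  case: b => -[|x b] // sb; rewrite /= => Pb.
  pose b' : n.-tuple bool := Tuple (sb : size b == n).
  have -> : Tuple sb = c x b' by apply: val_inj.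
  have {Pb} : P (x :: b') by [].
  by clearbody b'; clear sb; case: x => Pb; [left|right]; rewrite imset_f ?inE.
by case=> /imsetP[b']; rewrite inE => Pb' ->.
Qed.

Lemma subword_binomial_nil (T : finType) (x : T) (v : seq T) :
  subword_binomial [::] (x :: v) = 0.
Proof. by apply: eq_card0 => b; rewrite !inE mask0. Qed.

Lemma subword_binomial0 (T : finType) (u : seq T) : subword_binomial u [::] = 1.
Proof.
elim: u => [|c u IHu].
  apply: (@eq_card1 _ [tuple]) => b; rewrite !inE mask0.
  by rewrite tuple0 !eqxx.
rewrite /subword_binomial (card_set_cons _ (fun b => mask b (c :: u) == [::])).
by rewrite /= (eq_card0 (A := [set _ | _])) // => b; rewrite !inE.
Qed.

Lemma subword_binomial_cons (T : finType) (c x : T) (u v : seq T) :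
  subword_binomial (c :: u) (x :: v) =
  (c == x) * subword_binomial u v + subword_binomial u (x :: v).
Proof.
rewrite {1}/subword_binomial
  (card_set_cons _ (fun b => mask b (c :: u) == x :: v)) /=; congr (_ + _).
have [->|ne] := eqVneq c x.
  by rewrite mul1n; apply: eq_card => b; rewrite !inE eqseq_cons eqxx.
by apply: eq_card0 => b; rewrite !inE eqseq_cons (negPf ne).
Qed.

Lemma subword_binomial1 (T : finType) (u : seq T) (x : T) :
  subword_binomial u [:: x] = count_mem x u.
Proof.
elim: u => [|c u IHu]; first by rewrite subword_binomial_nil.
by rewrite subword_binomial_cons subword_binomial0 muln1 IHu.
Qed.

Lemma subword_binomial2_cat (T : finType) (u v : seq T) (x y : T) :
  subword_binomial (u ++ v) [:: x; y] =
  subword_binomial u [:: x; y] + subword_binomial v [:: x; y]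
  + count_mem x u * count_mem y v.
Proof.
elim: u => [|c u IHu] /=; first by rewrite subword_binomial_nil add0n addn0.
rewrite !subword_binomial_cons IHu !subword_binomial1 count_cat.
by move: (count_mem y u) (count_mem y v) (count_mem x u) (nat_of_bool _) => *; nia.
Qed.

Lemma perm_eq_count (T : eqType) (u v : seq T) :
  (forall x, count_mem x u = count_mem x v) -> perm_eq u v.
Proof. by move=> E; apply/allP => x _; apply/eqP/E. Qed.

Lemma binomial_equiv1P (T : finType) (u v : seq T) :
  reflect (perm_eq u v) (binomial_equiv 1 u v).
Proof.
apply: (iffP (binomial_equivP 1 u v)) => [E|/permP E [|x [|y l]] //= _].
- by apply: perm_eq_count => x; have := E [:: x] isT; rewrite !subword_binomial1.
- by rewrite !subword_binomial0.
by rewrite !subword_binomial1 E.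
Qed.

Lemma binomial_equiv2P (T : finType) (u v : seq T) :
  reflect (perm_eq u v /\ forall x y,
    subword_binomial u [:: x; y] = subword_binomial v [:: x; y])
    (binomial_equiv 2 u v).
Proof.
apply: (iffP (binomial_equivP 2 u v)) => [E|[/permP E E2] [|x [|y [|z l]]] //= _].
- split=> [|x y]; last exact: E.
  by apply: perm_eq_count => x; have := E [:: x] isT; rewrite !subword_binomial1.
- by rewrite !subword_binomial0.
by rewrite !subword_binomial1 E.
Qed.

(** * Counting equivalence classes by representatives *)

(** The quotient of A by R is given by a transversal indexed by a finite type,
    which allows the ambient type I to be infinite: classes of factors are
    counted on starting positions. *)
Definition num_classes (I : Type) (A : I -> Prop) (R : I -> I -> Prop)
    (N : nat) : Prop :=
  exists (D : finType) (g : D -> I),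
    [/\ #|D| = N, forall d, A (g d), forall d d', R (g d) (g d') -> d = d'
      & forall i, A i -> exists d, R i (g d)].

Lemma eq_num_classes (I : Type) (A : I -> Prop) (R R' : I -> I -> Prop) N :
  (forall i j, A i -> A j -> (R i j <-> R' i j)) ->
  num_classes A R N -> num_classes A R' N.
Proof.
move=> E [D [g [cD Ag gI gS]]]; exists D, g; split=> // [d d' r|i Ai].
  by apply: gI; apply/E.
by have [d r] := gS i Ai; exists d; apply/E.
Qed.

Lemma num_classes_image (I J : Type) (A : I -> Prop) (B : J -> Prop)
    (f : I -> J) (R : J -> J -> Prop) N :
  (forall i, A i -> B (f i)) ->
  (forall j, B j -> exists2 i, A i & f i = j) ->
  num_classes A (fun i i' => R (f i) (f i')) N <-> num_classes B R N.
Proof.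
move=> AB BA; split=> -[D [g [cD Ag gI gS]]].
  exists D, (f \o g); split=> //= [d|j /BA[i Ai <-]]; first exact: AB.
  exact: gS.
have /choice[h hP] : forall d, exists i, A i /\ f i = g d.
  by move=> d; have [i Ai e] := BA _ (Ag d); exists i.
exists D, h; split=> // [d|d d'|i Ai]; first by have [] := hP d.
  have [_ ->] := hP d; have [_ ->] := hP d'; exact: gI.
have [d r] := gS _ (AB _ Ai); exists d.
by have [_ ->] := hP d.
Qed.

Lemma num_classes_tag (I : Type) (R : I -> I -> Prop) (k : nat)
    (tag : I -> nat) (N : nat -> nat) :
  (forall i, tag i < k) -> (forall i j, R i j -> tag i = tag j) ->
  (forall r, r < k -> num_classes (fun i => tag i = r) R (N r)) ->
  num_classes (fun _ => True) R (\sum_(r < k) N r).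
Proof.
move=> tagk tagR C.
have /choice[D /(_ _)/cid HD] : forall r : 'I_k, exists D : finType,
    exists g : D -> I, [/\ #|D| = N r, forall d, tag (g d) = r,
      forall d d', R (g d) (g d') -> d = d'
      & forall i, tag i = r -> exists d, R i (g d)].
  by move=> r; apply: C.
pose g r := sval (HD r).
have gP r := svalP (HD r); rewrite -/(g _) in gP.
exists {r : 'I_k & D r}, (fun p => g (projT1 p) (projT2 p)); split=> //.
- rewrite card_tagged sumnE big_map big_enum /=.
  by apply: eq_bigr => r _; have [] := gP r.
- move=> [r d] [r' d'] /= Rd; have e := tagR _ _ Rd.
  have [_ t1 i1 _] := gP r; have [_ t2 _ _] := gP r'.
  move: e; rewrite t1 t2 => /val_inj e; move: d' Rd; rewrite -e => d' Rd.
  by rewrite (i1 _ _ Rd).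
move=> i _; have [_ _ _ /(_ i erefl)[d Rd]] := gP (Ordinal (tagk i)).
by exists (Tagged D d).
Qed.

Lemma card_equivalence_partition (T : finType) (R : rel T) (F : {set T}) N :
  equivalence_rel R ->
  num_classes (fun u => u \in F) R N <-> #|equivalence_partition R F| = N.
Proof.
move=> eR; have Rr x : R x x by have [] := eR x x x.
have Rt x y : R x y -> R x =1 R y by move=> xy z; have [_ ->] := eR x y z.
have Rs x y : R x y -> R y x by move=> xy; rewrite -(Rt _ _ xy) Rr.
pose cl x := [set y in F | R x y].
split=> [[D [g [<- gF gI gS]]]|<-].
  have clI : injective (cl \o g).
    move=> d d' /= /setP/(_ (g d')); rewrite !inE Rr gF /=; exact: gI.
  rewrite -(card_imset _ clI); apply: eq_card => X.
  apply/imsetP/imsetP => [[x /gS[d Rxd] ->]|[d _ ->]]; last by exists (g d).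
  by exists d => //; apply/setP => y; rewrite !inE (Rt _ _ Rxd).
pose D : finType := {X | X \in equivalence_partition R F}.
have /choice[g gP] : forall X : D,
    exists x, x \in F /\ val X = cl x.
  by case=> X /= /imsetP[x xF ->]; exists x.
exists D, g; split.
- by rewrite card_sig.
- by move=> d; have [] := gP d.
- move=> d d' Rd; apply: val_inj; have [_ ->] := gP d; have [_ ->] := gP d'.
  by apply/setP => y; rewrite !inE (Rt _ _ Rd).
move=> x xF; have clx : cl x \in equivalence_partition R F by apply: imset_f.
pose X : D := Sub (cl x) clx.
exists X; have [gF /setP/(_ x)] := gP X.
by rewrite !inE Rr xF /= => /esym/Rs.
Qed.

Definition window (T : Type) (s : nat -> T) (i n : nat) : seq T :=
  [seq s j | j <- iota i n].

Lemma size_window (T : Type) (s : nat -> T) i n : size (window s i n) = n.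
Proof. by rewrite size_map size_iota. Qed.

Lemma windowD (T : Type) (s : nat -> T) i a b :
  window s i (a + b) = window s i a ++ window s (i + a) b.
Proof. by rewrite /window iotaD map_cat. Qed.

Lemma num_classes_window (T : finType) (s : nat -> T) (k n N : nat) :
  num_classes (fun _ => True)
    (fun i j => binomial_equiv k (window s i n) (window s j n)) N <->
  binomial_complexity s k n = N.
Proof.
pose f i := [tuple of map s (iota_tuple n i)].
have fE i : tval (f i) = [seq s (i + j) | j <- iota 0 n].
  by rewrite /= -{1}[i]addn0 iotaDl -map_comp.
rewrite /binomial_complexity -card_equivalence_partition; last first.
  move=> u v w; exact: (@binomial_equiv_equivalence T k (tval u) (tval v) (tval w)).
rewrite -(@num_classes_image nat (n.-tuple T) (fun _ => True) _ f) //.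
  by move=> i _; rewrite inE; apply/asboolP; exists i.
move=> w; rewrite inE => /asboolP[i e]; exists i => //.
by apply: val_inj; exact: (etrans (fE i) (esym e)).
Qed.

(** * Words made of blocks and runs *)

Section Letters.

Variable m : nat.
Hypothesis m_gt1 : 1 < m.

Implicit Types (x y c d : 'Z_m) (w : seq 'Z_m).

Lemma ltn_Zp x : x < m.
Proof. by case: x => i /=; rewrite Zp_cast. Qed.

Lemma eq_natr_Zp a b : (a%:R == b%:R :> 'Z_m)%R = (a == b %[mod m]).
Proof. by rewrite -val_eqE /= !val_Zp_nat. Qed.

Lemma eq_natr_Zp_lt a x : a < m -> (a%:R == x)%R = (a == x).
Proof.
by move=> am; rewrite -val_eqE /= val_Zp_nat // modn_small.
Qed.

Definition run c k := [seq (c + i%:R)%R | i <- iota 0 k].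

Lemma runS c k : run c k.+1 = run c k ++ [:: (c + k%:R)%R].
Proof. by rewrite /run -[k.+1]addn1 iotaD map_cat. Qed.

Lemma size_run c k : size (run c k) = k.
Proof. by rewrite size_map size_iota. Qed.

(** The comparison of the representative of x - c with k serves as the indicator
    function of the letters of a run. *)
Lemma count_run c k x : k <= m -> count_mem x (run c k) = ((x - c)%R < k).
Proof.
elim: k => [|k IHk] // km; rewrite runS count_cat IHk ?(ltnW km) //.
have -> : count_mem x [:: c + k%:R]%R = (k == (x - c)%R).
  by rewrite -eq_natr_Zp_lt // eq_sym subr_eq addrC eq_sym /= addn0.
by move: (nat_of_ord _) => z; lia.
Qed.

(** Along consecutive letters, x comes before x-1 only in a full turn around the
    alphabet starting at x; this is why the pair x (x-1) is the informative
    one. *)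
Lemma pairs_run c k x : k <= m ->
  subword_binomial (run c k) [:: x; x - 1]%R = (x == c) && (k == m).
Proof.
elim: k => [|k IHk] km.
  by rewrite subword_binomial_nil [0 == m]ltn_eqF ?andbF // ltnW.
rewrite runS subword_binomial2_cat IHk ?(ltnW km) // count_run ?(ltnW km) //.
rewrite subword_binomial_cons subword_binomial1 subword_binomial_nil muln0.
have -> : count_mem (x - 1)%R [:: c + k%:R]%R = (k.+1 == (x - c)%R %[mod m]).
  rewrite -eq_natr_Zp natr_Zp /= addn0; congr nat_of_bool.
  by rewrite -subr_eq0 -[RHS]subr_eq0 mulrSr; congr (_ == _); ring.
have -> : (x == c) = (nat_of_ord (x - c)%R == 0) by rewrite -subr_eq0.
have := ltn_Zp (x - c)%R; move: (nat_of_ord (x - c)%R) => z zm.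
have [k1m|mk] := ltnP k.+1 m; first by rewrite !modn_small //; lia.
have mE : m = k.+1 by lia.
by move: zm m_gt1; rewrite mE => zm k_gt0; rewrite modnn modn_small //; lia.
Qed.

Lemma sigma_cons c w : sigma (c :: w) = run c m ++ sigma w.
Proof. by []. Qed.

Lemma count_sigma w x : count_mem x (sigma w) = size w.
Proof.
elim: w => // c w IHw; rewrite sigma_cons count_cat IHw count_run //.
by rewrite ltn_Zp.
Qed.

(** Each block contains every letter once, so that any two blocks contribute one
    occurrence of x y whose letters lie in different blocks; hence C(|w|,2). *)
Lemma pairs_sigma w x y :
  subword_binomial (sigma w) [:: x; y] =
  \sum_(c <- w) subword_binomial (run c m) [:: x; y] + 'C(size w, 2).
Proof.
elim: w => [|c w IHw]; first by rewrite big_nil subword_binomial_nil.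
rewrite sigma_cons subword_binomial2_cat IHw count_sigma count_run // ltn_Zp.
by rewrite big_cons /= binS bin1 mul1n -!addnA.
Qed.

Lemma adjacent_pairs_sigma w x :
  subword_binomial (sigma w) [:: x; x - 1]%R = count_mem x w + 'C(size w, 2).
Proof.
rewrite pairs_sigma; congr (_ + _); elim: w => [|c w IHw]; first by rewrite big_nil.
by rewrite big_cons IHw pairs_run // eqxx andbT eq_sym.
Qed.

(** The general shape of a factor; a factor of the fixed point of [sigma] has
    this form with k, l < m. *)
Definition blocks c k w d l := run c k ++ sigma w ++ run d l.

Lemma count_blocks c k w d l x : k < m -> l < m ->
  count_mem x (blocks c k w d l) = ((x - c)%R < k) + size w + ((x - d)%R < l).
Proof.
by move=> /ltnW km /ltnW lm; rewrite !count_cat count_sigma !count_run // addnA.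
Qed.

Lemma adjacent_pairs_blocks c k w d l x : k < m -> l < m ->
  subword_binomial (blocks c k w d l) [:: x; x - 1]%R =
  count_mem x w + 'C(size w, 2) + ((x - c)%R < k) * size w
  + size w * ((x - 1 - d)%R < l) + ((x - c)%R < k) * ((x - 1 - d)%R < l).
Proof.
move=> km lm; rewrite !subword_binomial2_cat count_cat !count_sigma.
rewrite !count_run ?(ltnW km) ?(ltnW lm) // adjacent_pairs_sigma.
rewrite !pairs_run ?(ltnW km) ?(ltnW lm) //.
by rewrite !ltn_eqF // !andbF; lia.
Qed.

(** Only the letter counts of w enter the pairs taken inside [sigma w], and only
    its length enters the pairs that involve one of the two runs. *)
Lemma perm_blocks_equiv c k w w' d l : perm_eq w w' ->
  binomial_equiv 2 (blocks c k w d l) (blocks c k w' d l).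
Proof.
move=> ww'; apply/binomial_equiv2P; split=> [|x y].
  by apply: perm_eq_count => z; rewrite !count_cat !count_sigma (perm_size ww').
rewrite !subword_binomial2_cat !count_cat !count_sigma !pairs_sigma.
by rewrite (perm_big _ ww') (perm_size ww').
Qed.

(** Going once around the cyclic alphabet returns to the starting value. *)
Lemma cyclic_monotone_const (g : 'Z_m -> int) :
  (forall x, g x <= g (x - 1))%R -> forall x y, g x = g y.
Proof.
move=> gS; suff H x y : (g x <= g y)%R.
  by move=> x y; apply: Order.POrderTheory.le_anti; rewrite !H.
rewrite -(subrK y x) addrC -(natr_Zp (x - y)%R).
elim: (nat_of_ord _) => [|k IHk]; first by rewrite addr0.
apply: Order.POrderTheory.le_trans IHk.
by rewrite (Order.POrderTheory.le_trans (gS _)) // mulrSr addrA addrK.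
Qed.

Lemma val_natr_Zp k x : k < m -> x = k%:R%R -> nat_of_ord x = k.
Proof. by move=> km ->; rewrite val_Zp_nat // modn_small. Qed.

Lemma predm_Zp : (m.-1)%:R%R = (-1)%R :> 'Z_m.
Proof. by apply: (addIr 1%R); rewrite addNr -mulrSr prednK ?pchar_Zp // ltnW. Qed.

Lemma run_not_full c k : k < m -> ((c - 1 - c)%R < k) = false.
Proof.
move=> km; rewrite (@val_natr_Zp m.-1) ?predm_Zp //; first by lia.
  by lia.
by ring.
Qed.

(** The first letter of a proper run is its only letter whose predecessor is
    outside, so a nonempty proper run is determined by its set of letters. *)
Lemma run_startP c k x : 0 < k < m ->
  ((x - c)%R < k) && ~~ ((x - 1 - c)%R < k) = (x == c).
Proof.
move=> /andP[k0 km]; have -> : (x == c) = (nat_of_ord (x - c)%R == 0).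
  by rewrite -subr_eq0.
have -> : (x - 1 - c = (x - c) - 1)%R by ring.
move: (x - c)%R => z; have zm := ltn_Zp z.
have [z0|z0] := eqVneq (nat_of_ord z) 0.
  have -> : (z - 1 = 0 - 1 - 0)%R by rewrite -[z]natr_Zp z0; ring.
  by rewrite run_not_full // z0 k0.
rewrite (@val_natr_Zp (z.-1) (z - 1)%R); [by lia|by lia|].
by rewrite -[in LHS](natr_Zp z) -{1}(prednK (n := z)) ?lt0n // mulrSr addrK.
Qed.

Lemma run_inj c k c' k' : k < m -> k' < m ->
  (forall x, ((x - c)%R < k) = ((x - c')%R < k')) ->
  k = k' /\ (0 < k -> c = c').
Proof.
move=> km km' E; have kk' : k = k'.
  rewrite -(size_run c k) -(size_run c' k'); apply: perm_size.
  by apply: perm_eq_count => x; rewrite !count_run ?(ltnW km) ?(ltnW km') // E.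
split=> // k0; rewrite -kk' in E; apply/eqP.
by rewrite -(@run_startP c' k) ?k0 // -!E run_startP ?k0.
Qed.

End Letters.

(** * The runs and the letter counts are invariants of the class *)

Section Rigidity.

Variable m : nat.
Hypothesis m_ge3 : 3 <= m.

Let m_gt1 : 1 < m := ltnW m_ge3.

Implicit Types (x y c d : 'Z_m) (w : seq 'Z_m).

(** What rigidity needs from the combinatorics of the infinite word: no cubes,
    and the letters around a square are forced, since a square xx is always cut
    by a block boundary between its two letters. For k = 0 the letter c is
    arbitrary. *)
Definition tame c k w d l : Prop :=
  [/\ k < m, l < m, m ^ 2 <= k + m * size w + l
    & forall x, w = nseq (size w) x ->
        [/\ size w <= 2, 0 < k -> (c + k%:R = x - 1)%R & d = (x + 1)%R]].

Lemma tame_size c k w d l : tame c k w d l -> m.-1 <= size w.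
Proof. by case=> km lm mn _; nia. Qed.

Lemma all_count_nseq w x : size w <= count_mem x w -> w = nseq (size w) x.
Proof.
move=> wx; apply/all_pred1P; rewrite all_count.
by rewrite eqn_leq count_size wx.
Qed.

(** The only case in which the letters of w cannot dominate the argument: w is a
    square, which the lower bound on the length allows only for m = 3. *)
Lemma tame_const c k w d l x : tame c k w d l -> size w <= count_mem x w ->
  [/\ m = 3, size w = 2, 0 < k, 0 < l & (c = x - 1 - k%:R)%R /\ d = (x + 1)%R].
Proof.
move=> T /all_count_nseq wx; have wm := tame_size T.
have [km lm mn /(_ x wx)[w2 cE dE]] := T.
have m3 : m = 3 by lia.
have w2' : size w = 2 by lia.
have k0 : 0 < k by rewrite w2' in mn; nia.
split=> //; first by rewrite w2' in mn; nia.
by rewrite -cE // addrK.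
Qed.

(** Let g = p - p', which is s' - s because the letter counts agree. Equality
    of the numbers of pairs x (x-1) reads
      K (g x - g (x-1)) + p x s (x-1) - p' x s' (x-1) = |w'|_x - |w|_x,
    so w' is a power of x wherever g increases and w is a power of y wherever g
    decreases. A nonconstant g does both, and then m = 3 and K = 2; the letter
    that follows the square belongs to both runs, and the two squares would put
    two letters in both runs of the same factor. *)
Lemma tame_eq_sizes c k w d l c' k' w' d' l' :
  tame c k w d l -> tame c' k' w' d' l' -> size w = size w' ->
  (forall x, count_mem x (blocks c k w d l) =
             count_mem x (blocks c' k' w' d' l')) ->
  (forall x, subword_binomial (blocks c k w d l) [:: x; x - 1]%R =
             subword_binomial (blocks c' k' w' d' l') [:: x; x - 1]%R) ->
  forall x, ((x - c)%R < k) = ((x - c')%R < k').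
Proof.
move=> T T' ww' E1 E2.
have wm := tame_size T; have [km lm mn _] := T; have [km' lm' mn' _] := T'.
pose p x : bool := (x - c)%R < k; pose p' x : bool := (x - c')%R < k'.
pose s x : bool := (x - d)%R < l; pose s' x : bool := (x - d')%R < l'.
have {}E1 x : p x + s x = p' x + s' x.
  by move: (E1 x); rewrite !count_blocks // -/(p x) -/(s x) -/(p' x) -/(s' x); lia.
have {}E2 x : count_mem x w + p x * size w + size w * s (x - 1)%R
      + p x * s (x - 1)%R =
    count_mem x w' + p' x * size w + size w * s' (x - 1)%R
      + p' x * s' (x - 1)%R.
  move: (E2 x); rewrite !adjacent_pairs_blocks // -ww'.
  by rewrite -/(p x) -/(p' x) -/(s (x - 1)%R) -/(s' (x - 1)%R); lia.
have cw x : count_mem x w <= size w by apply: count_size.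
have cw' x : count_mem x w' <= size w by rewrite ww'; apply: count_size.
(* Since p - p' = s' - s, the products of indicators never help: reaching
   equality needs the full length of w'. *)
have up x : p' x + p (x - 1)%R < p x + p' (x - 1)%R ->
    size w' <= count_mem x w'.
  move: (E1 x) (E1 (x - 1)%R) (E2 x) (cw x) (cw' x); rewrite -ww'.
  by case: (p x); case: (p' x); case: (p (x - 1)%R); case: (p' (x - 1)%R);
    case: (s x); case: (s' x); case: (s (x - 1)%R); case: (s' (x - 1)%R) => //=; lia.
have down x : p x + p' (x - 1)%R < p' x + p (x - 1)%R ->
    size w <= count_mem x w.
  move: (E1 x) (E1 (x - 1)%R) (E2 x) (cw x) (cw' x).
  by case: (p x); case: (p' x); case: (p (x - 1)%R); case: (p' (x - 1)%R);
    case: (s x); case: (s' x); case: (s (x - 1)%R); case: (s' (x - 1)%R) => //=; lia.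
pose g x : int := ((p x)%:Z - (p' x)%:Z)%R.
have g_const : (forall x y, g x = g y) -> forall x, p x = p' x.
  move=> gc x; have gx := gc x (c - 1)%R; have gx' := gc x (c' - 1)%R.
  move: gx gx'; rewrite /g /p /p' !run_not_full // -/(p x) -/(p' x).
  by case: (p x); case: (p' x) => //=; case: (_ < _); case: (_ < _) => //=; lia.
apply: g_const.
case: (boolP [exists x, p' x + p (x - 1)%R < p x + p' (x - 1)%R]); last first.
  rewrite negb_exists => /forallP H; apply: cyclic_monotone_const => x.
  by move: (H x); rewrite /g -leqNgt; lia.
case/existsP => x Hx.
case: (boolP [exists x, p x + p' (x - 1)%R < p' x + p (x - 1)%R]); last first.
  rewrite negb_exists => /forallP H a b; apply: oppr_inj.
  apply: (@cyclic_monotone_const m (fun x => - g x)%R) => z.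
  by move: (H z); rewrite /g -leqNgt; lia.
case/existsP => y Hy.
have [m3 w2' k0' l0' [cE' dE']] := tame_const T' (up _ Hx).
have [_ w2 k0 l0 [cE dE]] := tame_const T (down _ Hy).
exfalso.
have xy : x != y.
  by apply/eqP => xy; move: Hx Hy; rewrite xy; lia.
(* m = 3: both runs around the square xx contain x + 1, while the runs around yy
   share only y + 1. *)
have px' : p' (x + 1)%R.
  rewrite /p' cE' (_ : x + 1 - (x - 1 - k'%:R) = (2 + k')%:R)%R; last first.
    by rewrite natrD; ring.
  by rewrite val_Zp_nat // m3; lia.
have sx' : s' (x + 1)%R.
  by rewrite /s' dE' subrr.
have [px sx] : p (x + 1)%R /\ s (x + 1)%R.
  by move: (E1 (x + 1)%R); rewrite px' sx'; case: (p _); case: (s _).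
have zE : (x - y = (nat_of_ord (x - y)%R)%:R)%R by rewrite natr_Zp.
have z0 : nat_of_ord (x - y)%R != 0 by move: xy; rewrite -subr_eq0.
have z3 := ltn_Zp m_gt1 (x - y)%R.
move: px sx; rewrite /p /s dE cE.
rewrite (_ : x + 1 - (y + 1) = x - y)%R; last by ring.
rewrite (_ : x + 1 - (y - 1 - k%:R) = (nat_of_ord (x - y)%R + 2 + k)%:R)%R; last first.
  by rewrite !natrD natr_Zp; ring.
rewrite val_Zp_nat //; move: (nat_of_ord _) z0 z3 => z z0 z3.
by move: z3; rewrite m3 => z3; lia.
Qed.

(** If the second factor has one block more, then p - p' only takes the values 0
    and 1, and takes both: it is 0 at c-1 and 1 at d-1. Where it drops, w must
    be a square of x with x outside the first run and x-1 outside the second;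
    this makes both runs too short for a factor of length at least 9. *)
Lemma tame_le_size c k w d l c' k' w' d' l' :
  tame c k w d l -> tame c' k' w' d' l' ->
  (forall x, count_mem x (blocks c k w d l) =
             count_mem x (blocks c' k' w' d' l')) ->
  (forall x, subword_binomial (blocks c k w d l) [:: x; x - 1]%R =
             subword_binomial (blocks c' k' w' d' l') [:: x; x - 1]%R) ->
  size w' <= size w.
Proof.
move=> T T' E1 E2; rewrite leqNgt; apply/negP => ww'.
have wm := tame_size T; have [km lm mn _] := T; have [km' lm' mn' _] := T'.
pose p x : bool := (x - c)%R < k; pose p' x : bool := (x - c')%R < k'.
pose s x : bool := (x - d)%R < l; pose s' x : bool := (x - d')%R < l'.
have {}E1 x : p x + s x + size w = p' x + s' x + size w'.
  by move: (E1 x); rewrite !count_blocks // -/(p x) -/(s x) -/(p' x) -/(s' x); lia.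
have w'E : size w' = (size w).+1.
  move: (E1 (c - 1)%R); rewrite /p run_not_full //.
  by case: (s _); case: (p' _); case: (s' _); lia.
have {}E2 x : count_mem x w + p x * size w + size w * s (x - 1)%R
      + p x * s (x - 1)%R =
    count_mem x w' + size w + p' x * (size w).+1
      + (size w).+1 * s' (x - 1)%R + p' x * s' (x - 1)%R.
  move: (E2 x); rewrite !adjacent_pairs_blocks // w'E binS bin1.
  by rewrite -/(p x) -/(p' x) -/(s (x - 1)%R) -/(s' (x - 1)%R); lia.
have cw x : count_mem x w <= size w by apply: count_size.
have down x : p x + p' (x - 1)%R < p' x + p (x - 1)%R ->
    [/\ size w <= count_mem x w, ~~ p x & ~~ s (x - 1)%R].
  move: (E1 x) (E1 (x - 1)%R) (E2 x) (cw x); rewrite w'E.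
  by case: (p x); case: (p' x); case: (p (x - 1)%R); case: (p' (x - 1)%R);
    case: (s x); case: (s' x); case: (s (x - 1)%R); case: (s' (x - 1)%R) => //=;
    first [lia | split=> //; lia].
pose g x : int := ((p x)%:Z - (p' x)%:Z)%R.
case: (boolP [exists x, p x + p' (x - 1)%R < p' x + p (x - 1)%R]); last first.
  rewrite negb_exists => /forallP H.
  have /(_ (c - 1)%R (d - 1)%R) : forall a b, g a = g b.
    move=> a b; apply: oppr_inj.
    apply: (@cyclic_monotone_const m (fun x => - g x)%R) => z.
    by move: (H z); rewrite /g -leqNgt; lia.
  move: (E1 (c - 1)%R) (E1 (d - 1)%R); rewrite w'E /g.
  have -> : p (c - 1)%R = false by apply: run_not_full.
  have -> : s (d - 1)%R = false by apply: run_not_full.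
  by case: (s _); case: (p _); case: (p' _); case: (p' _); case: (s' _);
    case: (s' _) => /=; lia.
case/existsP => x /down[cx px sx].
have [m3 w2 k0 l0 [cE dE]] := tame_const T cx.
move: px sx; rewrite /p /s cE dE.
rewrite (_ : x - (x - 1 - k%:R) = (1 + k)%:R)%R; last by rewrite natrD; ring.
rewrite (_ : x - 1 - (x + 1) = 1%:R)%R; last first.
  have : (3%:R = 0 :> 'Z_m)%R by rewrite -{1}m3 pchar_Zp.
  by move=> e; apply/eqP; rewrite -subr_eq0 -oppr_eq0 -e; apply/eqP; ring.
rewrite !val_Zp_nat // m3 -m3.
by move: mn; rewrite w2 m3; lia.
Qed.

(** The 2-binomial class is the same thing as the two runs together with the
    abelian class of w. *)
Lemma blocks_equivP c k w d l c' k' w' d' l' :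
  tame c k w d l -> tame c' k' w' d' l' ->
  binomial_equiv 2 (blocks c k w d l) (blocks c' k' w' d' l') <->
  [/\ k = k' /\ (0 < k -> c = c'), l = l' /\ (0 < l -> d = d') & perm_eq w w'].
Proof.
move=> T T'; split; last first.
  case=> -[<- cc'] [<- dd'] ww'.
  have -> : blocks c' k w' d' l = blocks c k w' d l.
    rewrite /blocks; congr (_ ++ _ ++ _).
      by case: k cc' {T T'} => // k ->.
    by case: l dd' {T T'} => // l ->.
  exact: perm_blocks_equiv.
case/binomial_equiv2P => /permP E1 E2.
have [km lm mn _] := T; have [km' lm' mn' _] := T'.
have ww' : size w = size w'.
  apply/eqP; rewrite eqn_leq (tame_le_size T T') // (tame_le_size T' T) //.
have pE := tame_eq_sizes T T' ww' (fun x => E1 (pred1 x)) (fun x => E2 x (x - 1)%R).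
have sE x : ((x - d)%R < l) = ((x - d')%R < l').
  move: (E1 (pred1 x)); rewrite !count_blocks // pE ww'.
  by case: (_ < l); case: (_ < l'); lia.
split; [exact: run_inj|exact: run_inj|].
apply: perm_eq_count => x.
move/eqP: (E2 x (x - 1)%R).
by rewrite !adjacent_pairs_blocks // pE sE ww' !eqn_add2r => /eqP.
Qed.

End Rigidity.

(** * Counting configurations over the cyclic alphabet *)

Section Counting.

Variable m : nat.
Hypothesis m_gt1 : 1 < m.

Implicit Types x y z : 'Z_m.

Lemma card_Zp_type : #|{: 'Z_m}| = m.
Proof. by rewrite card_ord Zp_cast. Qed.

Lemma sum_count_Zp (v : seq 'Z_m) : \sum_x count_mem x v = size v.
Proof.
elim: v => [|c v IHv] /=; first by rewrite big1.
rewrite big_split IHv /= (bigD1 c) //= eqxx big1 // => x.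
by rewrite eq_sym => /negPf->.
Qed.

(** Letter counts with a fixed sum are determined by their differences between
    cyclically consecutive letters. *)
Lemma perm_eq_differences (v v' : seq 'Z_m) : size v = size v' ->
  perm_eq v v' <->
  forall x, count_mem x v + count_mem (x - 1 : 'Z_m)%R v' =
            count_mem x v' + count_mem (x - 1 : 'Z_m)%R v.
Proof.
move=> vv'; split=> [/permP E x|E]; first by rewrite !E addnC.
pose g x : int := ((count_mem x v)%:Z - (count_mem x v')%:Z)%R.
have g_const : forall x y, g x = g y.
  by apply: cyclic_monotone_const => x; move: (E x); rewrite /g; lia.
have [/eqP gp|] := boolP (g 0%R == 0%R).
  apply: perm_eq_count => x.
  by have := g_const x 0%R; rewrite gp /g; lia.
have lt_sum (s s' : seq 'Z_m) : size s = size s' ->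
    (forall x, count_mem x s < count_mem x s') -> False.
  move=> ss' lt; suff : size s < size s' by rewrite ss' ltnn.
  rewrite -!sum_count_Zp (bigD1 0%R) //= [X in _ < X](bigD1 0%R) //= -addSn.
  by apply: leq_add => //; apply: leq_sum => x _; apply/ltnW/lt.
rewrite Order.TotalTheory.neq_lt => /orP[] g0; exfalso.
  apply: (lt_sum v v') => // x.
  by have := g_const x 0%R; move: g0; rewrite /g; lia.
apply: (lt_sum v' v) => // x.
by have := g_const x 0%R; move: g0; rewrite /g; lia.
Qed.

(** Among the m ^ 2 pairs (a, e), the m pairs with e = 0 have one class each and
    the others have m classes each. *)
Lemma num_classes_forget_at_zero (I : Type) (a e i : I -> 'Z_m) :
  (forall x y z, exists j, [/\ a j = x, e j = y & i j = z]) ->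
  num_classes (fun _ => True)
    (fun j j' => [/\ a j = a j', e j = e j' & e j = 0%R \/ i j = i j'])
    (m * (m * m.-1 + 1)).
Proof.
move=> surj.
pose D : finType := ('Z_m * option ('Z_m * {x : 'Z_m | x != 0%R}))%type.
pose val3 (d : D) : 'Z_m * 'Z_m * 'Z_m :=
  (d.1, if d.2 is Some p then val p.2 else 0%R,
   if d.2 is Some p then p.1 else 0%R).
have /choice[g gP] : forall d : D, exists j, (a j, e j, i j) = val3 d.
  move=> d; have [j [aj ej ij]] := surj (val3 d).1.1 (val3 d).1.2 (val3 d).2.
  by exists j; rewrite aj ej ij; case: (val3 d) => [[]].
exists D, g; split=> //.
- rewrite card_prod card_option card_prod card_sig cardC1 card_Zp_type.
  by rewrite addn1.
- move=> [x o] [x' o']; have := gP (x, o); have := gP (x', o').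
  case=> -> -> -> [-> -> ->] /=.
  move=> [xx' yy' zz']; rewrite {}xx'; congr (_, _).
  case: o yy' zz' => [[z Y]|]; case: o' => [[z' Y']|] //=.
  + move=> yy' [Y0|->]; first by have := valP Y; rewrite /= Y0 eqxx.
    by congr (Some (_, _)); apply: val_inj.
  + by move=> Y0; have := valP Y; rewrite /= Y0 eqxx.
  by move=> Y0; have := valP Y'; rewrite /= -Y0 eqxx.
move=> j _; case: (eqVneq (e j) 0%R) => ej.
  by exists (a j, None); have [-> -> _] := gP (a j, None); rewrite ej; split=> //; left.
exists (a j, Some (i j, Sub (e j) ej)).
by have [-> -> ->] := gP (a j, Some (i j, Sub (e j) ej)); split=> //; right.
Qed.

(** Equality of the functions [x = y] + [x = z] - [x = y + z] for (y, z) and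
    (y', z'), with the negative terms moved to the other side. *)
Definition deltas y z y' z' : Prop := forall x,
  (x == y) + (x == z) + (x == y' + z')%R = (x == y') + (x == z') + (x == y + z)%R.

Lemma deltas_nonzero y z y' z' : y != 0%R -> z != 0%R ->
  deltas y z y' z' -> y = y' /\ z = z' \/ y = z' /\ z = y'.
Proof.
have sum_neq (u v : 'Z_m) : v != 0%R -> (u == u + v)%R = false.
  by move=> v0; apply/negbTE; rewrite -[X in X == _]addr0 (inj_eq (addrI u)) eq_sym.
have sum_neq' (u v : 'Z_m) : v != 0%R -> (u == v + u)%R = false.
  by move=> v0; rewrite addrC sum_neq.
move=> y0 z0 H.
case: (eqVneq y' 0%R) => [y0'|y0']; last case: (eqVneq z' 0%R) => [z0'|z0'].
- move: (H y); rewrite y0' add0r sum_neq // eqxx (negPf y0).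
  by case: (_ == _); case: (_ == _); lia.
- move: (H y); rewrite z0' addr0 sum_neq // eqxx (negPf y0).
  by case: (_ == _); case: (_ == _); lia.
move: (H y); rewrite eqxx sum_neq //.
case: (eqVneq y y') => [yy' _|_].
  subst y'; left; split=> //.
  move: (H z); rewrite eqxx sum_neq' //; case: (eqVneq z z') => // _.
  by case: (z == y); case: (_ == _); lia.
case: (eqVneq y z') => [yz' _|_]; last by case: (_ == _); case: (_ == _); lia.
subst z'; right; split=> //.
move: (H z); rewrite eqxx sum_neq' //; case: (eqVneq z y') => // _.
by case: (z == y); case: (_ == _); lia.
Qed.

(** When y or z vanishes, a cancellation leaves the same function [x = 0] in all
    cases. Otherwise y + z differs from both y and z, so the positive part
    recovers the unordered pair. *)
Lemma deltasP y z y' z' : deltas y z y' z' <->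
  [\/ ((y == 0) || (z == 0)) /\ ((y' == 0) || (z' == 0)),
      y = y' /\ z = z' | y = z' /\ z = y']%R.
Proof.
split; last first.
  move=> H x; case: H => [[/orP[]/eqP-> /orP[]/eqP->]|[-> ->]|[-> ->]] //.
  - by rewrite !add0r; lia.
  - by rewrite addr0 add0r; lia.
  - by rewrite addr0 add0r; lia.
  - by rewrite !addr0; lia.
  by rewrite addrC [(z' + y')%R]addrC; lia.
move=> H; have H' : deltas y' z' y z by move=> x; rewrite -H.
have [|/norP[y0 z0]] := boolP ((y == 0) || (z == 0))%R; last first.
  by case: (deltas_nonzero y0 z0 H); [constructor 2|constructor 3].
have [|/norP[y0' z0']] := boolP ((y' == 0) || (z' == 0))%R.
  by constructor 1.
case: (deltas_nonzero y0' z0' H') => -[<- <-].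
  by constructor 2.
by constructor 3.
Qed.

(** An unordered pair {y, z} of nonzero residues with representatives y <= z is
    encoded by z and y - 1 < z, that is, by a pair i < j below m; this gives
    C(m,2) classes besides the degenerate one. *)
Lemma num_classes_deltas (I : Type) (b y z : I -> 'Z_m) :
  (forall u v w, exists j, [/\ b j = u, y j = v & z j = w]) ->
  num_classes (fun _ => True)
    (fun j j' => b j = b j' /\ deltas (y j) (z j) (y j') (z j'))
    (m * ('C(m, 2) + 1)).
Proof.
move=> surj.
pose D : finType := ('Z_m * option {j : 'I_m & 'I_j})%type.
pose val2 (o : option {j : 'I_m & 'I_j}) : 'Z_m * 'Z_m :=
  if o is Some p then ((tagged p).+1%:R, (tag p)%:R)%R else (0, 0)%R.
have /choice[g gP0] : forall d : D, exists j, (b j, (y j, z j)) = (d.1, val2 d.2).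
  move=> d; have [j [bj yj zj]] := surj d.1 (val2 d.2).1 (val2 d.2).2.
  by exists j; rewrite bj yj zj; case: (val2 _).
have gPb d : b (g d) = d.1 by case: (gP0 d).
have gP d : (y (g d), z (g d)) = val2 d.2 by case: (gP0 d).
have gPy d : y (g d) = (val2 d.2).1 by rewrite -gP.
have gPz d : z (g d) = (val2 d.2).2 by rewrite -gP.
have nz k : 0 < k < m -> (k%:R == 0 :> 'Z_m)%R = false.
  by move=> /andP[k0 km]; rewrite eq_natr_Zp_lt // (gtn_eqF k0).
have inj k k' : k < m -> k' < m -> (k%:R = k'%:R :> 'Z_m)%R -> k = k'.
  by move=> km km' /eqP; rewrite eq_natr_Zp // !modn_small // => /eqP.
exists D, g; split=> //.
- rewrite card_prod card_option card_tagged card_Zp_type; congr (_ * _).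
  rewrite addn1 sumnE big_map big_enum /= -bin2_sum big_mkord; congr _.+1.
  by apply: eq_bigr => i _; rewrite card_ord.
- move=> [u o] [u' o']; rewrite !gPb !gPy !gPz /= => -[-> /deltasP H].
  congr (_, _); case: o o' H => [[k i]|] [[k' i']|] //=.
  + have km := ltn_ord k; have ik := ltn_ord i.
    have km' := ltn_ord k'; have ik' := ltn_ord i'.
    rewrite !nz /=; [|by lia|by lia|by lia|by lia].
    move=> H; have [kk' ii'] : nat_of_ord k = k' /\ nat_of_ord i = i'.
      case: H => [[]//|[/inj e1 /inj e2]|[/inj e1 /inj e2]].
        by split; [apply: e2|apply/succn_inj/e1]; lia.
      have {}e1 : i.+1 = k' by apply: e1; lia.
      have {}e2 : nat_of_ord k = i'.+1 by apply: e2; lia.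
      by split; lia.
    have {}kk' : k = k' by apply: val_inj.
    by subst k'; congr (Some (Tagged _ _)); apply: val_inj.
  + have km := ltn_ord k; have ik := ltn_ord i.
    rewrite !nz /=; [|by lia|by lia].
    case=> [[]//|[/eqP + _]|[/eqP + _]]; rewrite nz //; lia.
  have km := ltn_ord k'; have ik := ltn_ord i'.
  rewrite !nz /=; [|by lia|by lia].
  case=> [[]//|[/esym/eqP + _]|[_ /esym/eqP +]]; rewrite nz //; lia.
suff H (v w : 'Z_m) : exists o, deltas v w (val2 o).1 (val2 o).2.
  move=> j _; have [o Ho] := H (y j) (z j).
  by exists (b j, o); rewrite gPb gPy gPz.
have [vw|/norP[v0 w0]] := boolP ((v == 0) || (w == 0))%R.
  by exists None; apply/deltasP; constructor 1; split.
wlog vw : v w v0 w0 / v <= w.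
  move=> W; case: (leqP v w) => [|/ltnW] /W => [|/(_ w0 v0)]; first exact.
  by case=> o Ho; exists o => x; rewrite [(v + w)%R]addrC -Ho [(x == v) + _]addnC.
have v1 : v.-1 < w by have := v0; rewrite -val_eqE /=; lia.
exists (Some (Tagged (fun k : 'I_m => 'I_k)
   (Ordinal v1 : 'I_(Ordinal (ltn_Zp m_gt1 w))))).
apply/deltasP; constructor 2; rewrite /= natr_Zp; split=> //.
by rewrite prednK ?natr_Zp // lt0n.
Qed.

End Counting.

(** * The generalized Thue-Morse word *)

Section ThueMorse.

Variable m : nat.
Hypothesis m_gt1 : 1 < m.

Local Notation t := (thue_morse m).

Lemma thue_morse_block q i : i < m -> (t (m * q + i) = t q + i%:R)%R.
Proof.
move=> im; have := sigma_thue_morse q.+1 m_gt1.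
rewrite {1}/mkseq -[q.+1]addn1 iotaD map_cat sigma_cat -/(mkseq _ _) /=.
rewrite sigma_thue_morse // addn1.
move=> /(congr1 (fun s => nth 0%R s (m * q + i))).
rewrite nth_cat size_mkseq ltnNge leq_addr /= addKn.
rewrite [sigma _]cats0 nth_mkseq ?mulnSr ?ltn_add2l // => <-.
by rewrite (nth_map 0) ?size_iota // nth_iota.
Qed.

Lemma thue_morse_mul q : t (m * q) = t q.
Proof. by rewrite -[m * q]addn0 thue_morse_block ?addr0 // ltnW. Qed.

Lemma thue_morseS q : ~~ (m %| q.+1) -> (t q.+1 = t q + 1)%R.
Proof.
have m_gt0 := ltnW m_gt1; have rm := ltn_pmod q m_gt0.
rewrite {1 2 3}(divn_eq q m) mulnC -addnS dvdn_addr ?dvdn_mulr // => ndiv.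
have r1m : (q %% m).+1 < m.
  by rewrite ltn_neqAle rm andbT; apply: contraNneq ndiv => ->.
by rewrite !thue_morse_block // mulrSr addrA.
Qed.

Lemma window_run q i k : i + k <= m -> window t (m * q + i) k = run (t (m * q + i)) k.
Proof.
move=> ikm; rewrite /window /run -{1}[m * q + i]addn0 iotaDl -map_comp.
apply/eq_in_map => j; rewrite mem_iota => /= jk.
by rewrite -addnA !thue_morse_block ?natrD ?addrA //; lia.
Qed.

Lemma window_sigma q l : window t (m * q) (m * l) = sigma (window t q l).
Proof.
elim: l q => [|l IHl] q; first by rewrite muln0.
rewrite /window /= -!/(window _ _ _) sigma_cons // -IHl mulnS windowD.
by rewrite -mulnSr -{1}[m * q]addn0 window_run // addn0 thue_morse_mul.
Qed.

(** Here k is the distance from P to the next block boundary m q. *)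
Lemma window_blocks P k q K e : k < m -> P + k = m * q -> e < m ->
  window t P (k + m * K + e) = blocks (t P) k (window t q K) (t (q + K)) e.
Proof.
move=> km Pk em; rewrite -addnA !windowD Pk window_sigma -mulnDr /blocks.
congr (_ ++ (_ ++ _)).
  case: q Pk => [|q] Pk; first by have -> : k = 0 by lia.
  have -> : P = m * q + (m - k) by nia.
  by rewrite window_run // subnK // ltnW.
by rewrite -[m * _]addn0 window_run ?addn0 ?thue_morse_mul // ltnW.
Qed.

(** Passing from q to m q + (m-1) replaces the pair (t q, t (q+1)) by
    (t q - 1, t (q+1)): each carry in base m lowers the first letter by
    one. Iterating this from a pair (d - 1, d) gives all pairs with second
    letter d. *)
Lemma thue_morse_adjacent (c d : 'Z_m) : exists q, t q = c /\ t q.+1 = d.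
Proof.
have step q : exists q', (t q' = t q - 1)%R /\ t q'.+1 = t q.+1.
  have E : (m * q + m.-1).+1 = m * q.+1 by rewrite -addnS prednK ?mulnSr // ltnW.
  exists (m * q + m.-1); rewrite E thue_morse_mul; split=> //.
  rewrite thue_morse_block ?prednK //; last by rewrite ltnW.
  by rewrite predm_Zp.
suff H k : exists q, (t q = d - 1 - k%:R)%R /\ t q.+1 = d.
  have [q []] := H (d - 1 - c)%R.
  by rewrite natr_Zp opprB addrC subrK; exists q.
elim: k => [|k [q [qE dE]]].
  exists (m * (d - 1)%R); rewrite thue_morse_mul.
  have tE : t (d - 1)%R = (d - 1)%R.
    have := thue_morse_block 0 (ltn_Zp m_gt1 (d - 1)%R).
    by rewrite muln0 !add0n natr_Zp => ->; rewrite -[RHS]add0r.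
  rewrite tE subr0; split=> //.
  have d1 : ~~ (m %| (m * (d - 1)%R).+1).
    by rewrite -addn1 dvdn_addr ?dvdn_mulr // dvdn1; lia.
  by rewrite thue_morseS // thue_morse_mul tE subrK.
have [q' [E1 E2]] := step q; exists q'; rewrite E1 E2 qE; split=> //.
by rewrite mulrSr; ring.
Qed.

(** Induction on the distance L in base m: for L >= m the first letter is read at the
    start of a block, and for L < m one block boundary is crossed, which reduces to
    adjacent letters. *)
Lemma thue_morse_pair L (c d : 'Z_m) : 0 < L -> exists q, t q = c /\ t (q + L) = d.
Proof.
elim/ltn_ind: L c d => L IHL c d L0; have m_gt0 := ltnW m_gt1.
have [Lm|mL] := ltnP L m.
  have [q [qE qE']] := thue_morse_adjacent (c + L%:R)%R d.
  exists (m * q + (m - L)); rewrite -addnA subnK ?(ltnW Lm) // -mulnSr.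
  rewrite thue_morse_mul thue_morse_block ?qE; last by lia.
  by rewrite natrB ?(ltnW Lm) // pchar_Zp //; split=> //; ring.
have [q [qE qE']] : exists q, t q = c /\ (t (q + L %/ m) = d - (L %% m)%:R)%R.
  by apply: IHL; rewrite ?ltn_Pdiv ?divn_gt0.
exists (m * q); rewrite thue_morse_mul {1}(divn_eq L m) [_ * m]mulnC addnA.
by rewrite -mulnDr thue_morse_block ?ltn_pmod // qE' subrK.
Qed.

Lemma thue_morse_pair_mod L (a b i : 'Z_m) : m <= L ->
  exists q, [/\ t q = a, t (q + L) = b & q%:R%R = i].
Proof.
move=> mL; have im := ltn_Zp m_gt1 i; have m_gt0 := ltnW m_gt1.
have [|q [qa qb]] := @thue_morse_pair ((i + L) %/ m) (a - i)%R
    (b - ((i + L) %% m)%:R)%R.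
  by rewrite divn_gt0 // (leq_trans mL) // leq_addl.
exists (m * q + i); split.
- by rewrite thue_morse_block // qa natr_Zp subrK.
- rewrite -addnA {1}(divn_eq (i + L) m) [_ * m]mulnC addnA -mulnDr.
  by rewrite thue_morse_block ?ltn_pmod // qb subrK.
by rewrite natrD natrM pchar_Zp // mul0r add0r natr_Zp.
Qed.

(** Whole blocks contain each letter once and do not contribute to differences,
    so only the two blocks containing q and q + l do; t q - q is the first
    letter of the block that contains q. *)
Lemma window_differences q l (x : 'Z_m) :
  count_mem x (window t q l) + (x == t (q + l)) + (x == t q - q%:R)%R =
  count_mem (x - 1 : 'Z_m)%R (window t q l)
    + (x == t (q + l) - (q + l)%:R)%R + (x == t q).
Proof.
elim: l => [|l IHl]; first by rewrite addn0 /=; lia.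
rewrite -[l.+1]addn1 windowD !count_cat /= addn1 !addn0 addnS.
set b := t (q + l) in IHl *; set b' := t (q + l).+1.
have bx : (b == x - 1)%R = (x == b + 1)%R by rewrite eq_sym subr_eq.
suff : (x == b') + (x == b - (q + l)%:R)%R = (x == b + 1)%R + (x == b' - (q + l).+1%:R)%R.
  move: IHl; rewrite bx [b == x]eq_sym.
  set c1 := count_mem x _; set c2 := count_mem _ _; set e1 := (x == b) : nat.
  set e2 := (x == b') : nat; set e3 := (x == b + 1)%R : nat.
  set e4 := (x == t q) : nat; set e5 := (x == t q - _)%R : nat.
  set e6 := (x == b - _)%R : nat; set e7 := (x == b' - _)%R : nat.
  by lia.
have [dv|ndv] := boolP (m %| (q + l).+1).
  have -> : ((q + l).+1%:R = 0 :> 'Z_m)%R.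
    by case/dvdnP: dv => k ->; rewrite natrM pchar_Zp // mulr0.
  rewrite subr0 addnC; congr (nat_of_bool (x == _) + _).
  have : ((q + l).+1%:R = 0 :> 'Z_m)%R.
    by case/dvdnP: dv => k ->; rewrite natrM pchar_Zp // mulr0.
  by rewrite mulrSr => /(canRL (addrK 1))%R ->; ring.
by rewrite /b' thue_morseS // -/b mulrSr; congr (_ + nat_of_bool (x == _)); ring.
Qed.

Lemma perm_eq_window q q' l :
  perm_eq (window t q l) (window t q' l) <->
  forall x : 'Z_m,
    (x == t (q' + l)) + (x == t q' - q'%:R)%R
      + (x == t (q + l) - (q + l)%:R)%R + (x == t q) =
    (x == t (q + l)) + (x == t q - q%:R)%R
      + (x == t (q' + l) - (q' + l)%:R)%R + (x == t q').
Proof.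
rewrite perm_eq_differences ?size_window //.
split=> E x; move: (E x) (window_differences q l x) (window_differences q' l x).
  set c1 := count_mem x _; set c2 := count_mem _ _.
  set c3 := count_mem x _; set c4 := count_mem _ _.
  by move=> ? ? ?; lia.
set c1 := count_mem x _; set c2 := count_mem _ _.
set c3 := count_mem x _; set c4 := count_mem _ _.
by move=> ? ? ?; lia.
Qed.

(** With e = b - l - a, equality of the differences becomes
    [x = a - q'] + [x = a - q + e] = [x = a - q] + [x = a - q' + e],
    which holds if and only if e = 0 or q = q' modulo m. *)
Lemma num_classes_both_ends l : m <= l ->
  num_classes (fun _ => True)
    (fun q q' => [/\ t q = t q', t (q + l) = t (q' + l)
                    & perm_eq (window t q l) (window t q' l)])
    (m * (m * m.-1 + 1)).
Proof.
move=> ml; pose e q := (t (q + l) - l%:R - t q)%R.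
have surj (x y z : 'Z_m) : exists q, [/\ t q = x, e q = y & q%:R%R = z].
  have [q [qx qy qz]] := thue_morse_pair_mod x (y + x + l%:R)%R z ml.
  by exists q; split=> //; rewrite /e qy qx; ring.
apply: eq_num_classes (num_classes_forget_at_zero m_gt1 surj) => q q' _ _.
have bE j : t (j + l) = (e j + t j + l%:R)%R by rewrite /e; ring.
split=> -[aa' ee' H]; split=> //.
- by rewrite !bE ee' aa'.
- apply/perm_eq_window => x; rewrite !bE -aa' -ee'.
  case: H => [->|H]; last by rewrite !natrD -H.
  rewrite (_ : 0 + t q + l%:R - (q + l)%:R = t q - q%:R)%R; last first.
    by rewrite natrD; ring.
  rewrite (_ : 0 + t q + l%:R - (q' + l)%:R = t q - q'%:R)%R; last first.
    by rewrite natrD; ring.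
  by lia.
- by rewrite /e aa' ee'.
have [->|qq'] := eqVneq (q%:R : 'Z_m)%R (q'%:R)%R; [by right|left].
have eE : e q = e q' by rewrite /e aa' ee'.
move/perm_eq_window/(_ (t q - q%:R)%R): H; rewrite !bE -aa' -eE eqxx.
rewrite (inj_eq (addrI _)) (inj_eq oppr_inj) (negPf qq').
rewrite (_ : e q + t q + l%:R - (q + l)%:R = t q - q%:R + e q)%R; last first.
  by rewrite natrD; ring.
case: (eqVneq (e q) 0%R) => // e0.
have -> : (t q - q%:R == t q - q%:R + e q)%R = false.
  by apply/negbTE; rewrite eq_sym -subr_eq0 addrAC subrr add0r.
by set u1 := (_ == _); set u2 := (_ == _); set u3 := (_ == _); lia.
Qed.

(** Differences of windows with one end fixed are [deltas] after translation by
    b, up to a common term c. *)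
Lemma deltas_shift (c b : 'Z_m) y z y' z' :
  deltas y z y' z' <->
  forall x : 'Z_m,
    (x == c) + (x == y' + z' + b)%R + (x == z + b)%R + (x == y + b)%R =
    (x == c) + (x == y + z + b)%R + (x == z' + b)%R + (x == y' + b)%R.
Proof.
split=> E x.
  have := E (x - b)%R; rewrite !subr_eq.
  set c1 := (x == y + b)%R; set c2 := (x == z + b)%R; set c3 := (x == y + z + b)%R.
  set d1 := (x == y' + b)%R; set d2 := (x == z' + b)%R.
  by set d3 := (x == y' + z' + b)%R; lia.
have := E (x + b)%R; rewrite !(inj_eq (addIr b)).
set c1 := (x == y); set c2 := (x == z); set c3 := (x == y + z)%R.
set d1 := (x == y'); set d2 := (x == z').
by set d3 := (x == y' + z')%R; lia.
Qed.

(** Once b is known, the differences are those of [deltas] at y = a - (b - l) and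
    z = - q, translated by b - l. *)
Lemma num_classes_right_end l : m <= l ->
  num_classes (fun _ => True)
    (fun q q' => t (q + l) = t (q' + l)
                 /\ perm_eq (window t q l) (window t q' l))
    (m * ('C(m, 2) + 1)).
Proof.
move=> ml; pose y q := (t q - (t (q + l) - l%:R))%R; pose z q : 'Z_m := (- q%:R)%R.
have surj u v w : exists q, [/\ t (q + l) = u, y q = v & z q = w].
  have [q [qa qb qw]] := thue_morse_pair_mod (v + (u - l%:R))%R u (- w)%R ml.
  by exists q; split=> //; rewrite /y /z ?qw ?qa ?qb; ring.
apply: eq_num_classes (num_classes_deltas m_gt1 surj) => q q' _ _.
suff E : t (q + l) = t (q' + l) ->
    perm_eq (window t q l) (window t q' l) <-> deltas (y q) (z q) (y q') (z q').
  by split=> -[bb' /(E bb')].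
move=> bb'; pose b := (t (q + l) - l%:R)%R.
have yE : t q = (y q + b)%R by rewrite /y /b; ring.
have yE' : t q' = (y q' + b)%R by rewrite /y /b bb'; ring.
have zE : (t (q + l) - (q + l)%:R = z q + b)%R by rewrite /z /b natrD; ring.
have zE' : (t (q' + l) - (q' + l)%:R = z q' + b)%R.
  by rewrite /z /b bb' natrD; ring.
have yzE : (t q - q%:R = y q + z q + b)%R by rewrite yE /z; ring.
have yzE' : (t q' - q'%:R = y q' + z q' + b)%R by rewrite yE' /z; ring.
rewrite perm_eq_window zE zE' yzE yzE' yE yE' bb'.
by rewrite -deltas_shift.
Qed.

(** The mirror image of [num_classes_right_end]: once a is known, y = b - (a + l)
    and z = - (q + l), translated by a + l. *)
Lemma num_classes_left_end l : m <= l ->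
  num_classes (fun _ => True)
    (fun q q' => t q = t q' /\ perm_eq (window t q l) (window t q' l))
    (m * ('C(m, 2) + 1)).
Proof.
move=> ml; pose y q := (t (q + l) - (t q + l%:R))%R.
pose z q : 'Z_m := (- (q + l)%:R)%R.
have surj u v w : exists q, [/\ t q = u, y q = v & z q = w].
  have [q [qa qb qw]] := thue_morse_pair_mod u (v + (u + l%:R))%R (- w - l%:R)%R ml.
  by exists q; split=> //; rewrite /y /z ?natrD ?qw ?qa ?qb; ring.
apply: eq_num_classes (num_classes_deltas m_gt1 surj) => q q' _ _.
suff E : t q = t q' ->
    perm_eq (window t q l) (window t q' l) <-> deltas (y q) (z q) (y q') (z q').
  by split=> -[aa' /(E aa')].
move=> aa'; pose b := (t q + l%:R)%R.
have yE : t (q + l) = (y q + b)%R by rewrite /y /b; ring.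
have yE' : t (q' + l) = (y q' + b)%R by rewrite /y /b aa'; ring.
have zE : (t q - q%:R = z q + b)%R by rewrite /z /b natrD; ring.
have zE' : (t q' - q'%:R = z q' + b)%R by rewrite /z /b aa' natrD; ring.
have yzE : (t (q + l) - (q + l)%:R = y q + z q + b)%R by rewrite yE /z; ring.
have yzE' : (t (q' + l) - (q' + l)%:R = y q' + z q' + b)%R by rewrite yE' /z; ring.
rewrite perm_eq_window yzE yzE' zE zE' yE yE' aa' (deltas_shift (t q') b).
by split=> E x; have := E x;
  set c1 := (x == y q + b)%R; set c2 := (x == z q + b)%R;
  set c3 := (x == y q + z q + b)%R; set d1 := (x == y q' + b)%R;
  set d2 := (x == z q' + b)%R; set d3 := (x == y q' + z q' + b)%R; lia.
Qed.

(** Two equal adjacent letters can only occur across a block boundary, and two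
    block boundaries are at least m letters apart; hence there is no cube, and
    next to a square the letters increase by one. *)
Lemma tame_window P k q K e : 3 <= m -> k < m -> P + k = m * q -> e < m ->
  m ^ 2 <= k + m * K + e -> tame (t P) k (window t q K) (t (q + K)) e.
Proof.
move=> m3 km Pk em mn; split=> //; rewrite ?size_window // => x /esym wE.
have K2 : 1 < K by nia.
have wx j : j < K -> t (q + j) = x.
  move=> jK; have := congr1 (fun s => nth 0%R s j) wE.
  by rewrite nth_nseq jK (nth_map 0) ?size_iota // nth_iota.
have addr1_neq (y : 'Z_m) : y <> (y + 1)%R.
  move=> /eqP; rewrite eq_sym -subr_eq0 addrAC subrr add0r => /eqP y1.
  have := @eq_natr_Zp_lt m m_gt1 1 0%R m_gt1.
  by rewrite y1 eqxx.
have dvd_eq j : j.+1 < K -> m %| (q + j).+1.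
  move=> jK; apply: contraT => ndv; have := thue_morseS ndv.
  by rewrite -addnS !wx // ?(ltnW jK) // => /addr1_neq.
have dv0 := dvd_eq 0 K2; rewrite addn0 in dv0.
have ndvS j : m %| j -> 0 < j -> ~~ (m %| j.+1).
  move=> jm j0; rewrite -addn1 dvdn_addr // dvdn1; lia.
have x0 := wx 0 (ltnW K2); rewrite addn0 in x0.
have KE : K = 2.
  apply/eqP; rewrite eqn_leq K2 andbT leqNgt; apply/negP => K3.
  by have := dvd_eq 1 K3; rewrite addn1 (negPf (ndvS _ dv0 _)).
split; first by rewrite KE.
- move=> k0; case: q Pk dv0 x0 {wE wx dvd_eq} => [|q] Pk dv0 x0; first by lia.
  have PE : P = m * q + (m - k) by nia.
  have ndv : ~~ (m %| q.+1).
    by apply/negP => dv; have := ndvS _ dv isT; rewrite dv0.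
  have := thue_morseS ndv; rewrite x0 => ->.
  rewrite PE thue_morse_block ?natrB ?(ltnW km) ?pchar_Zp //; last by lia.
  by ring.
rewrite KE addn2 thue_morseS ?ndvS //.
by have := wx 1 K2; rewrite addn1 => ->.
Qed.

End ThueMorse.

(** * Classes of factors starting at a given residue *)

Section Fibers.

Variables m n : nat.
Hypotheses (m_ge3 : 3 <= m) (n_large : m ^ 2 <= n).

Let m_gt1 : 1 < m := ltnW m_ge3.
Let m_gt0 : 0 < m := ltnW m_gt1.

Local Notation t := (thue_morse m).
Local Notation equiv P P' := (binomial_equiv 2 (window t P n) (window t P' n)).

Lemma window_equivP P k q K e P' k' q' K' e' :
  k < m -> P + k = m * q -> e < m -> n = k + m * K + e ->
  k' < m -> P' + k' = m * q' -> e' < m -> n = k' + m * K' + e' ->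
  equiv P P' <->
  [/\ k = k' /\ (0 < k -> t P = t P'),
      e = e' /\ (0 < e -> t (q + K) = t (q' + K'))
    & perm_eq (window t q K) (window t q' K')].
Proof.
move=> km Pk em nE km' Pk' em' nE'.
have T : tame (t P) k (window t q K) (t (q + K)) e.
  by apply: tame_window; rewrite -?nE.
have T' : tame (t P') k' (window t q' K') (t (q' + K')) e'.
  by apply: tame_window; rewrite -?nE'.
rewrite -(blocks_equivP m_ge3 T T').
rewrite -(window_blocks m_gt1 K km Pk em) -(window_blocks m_gt1 K' km' Pk' em').
by rewrite -nE -nE'.
Qed.

(** The residue of P is read off from the length of the first run. *)
Lemma equiv_same_residue P P' : equiv P P' -> P %% m = P' %% m.
Proof.
have off Q : exists k q K e,
    [/\ k < m, Q + k = m * q, e < m & n = k + m * K + e].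
  pose k := (m - Q %% m) %% m; have km : k < m by apply: ltn_pmod.
  have kn : k <= n by nia.
  exists k, ((Q + k) %/ m), ((n - k) %/ m), ((n - k) %% m).
  split=> //; last by rewrite -addnA mulnC -divn_eq subnKC.
    rewrite mulnC divnK // /dvdn modnDmr -modnDml subnKC ?modnn //.
    by rewrite ltnW ?ltn_pmod.
  by rewrite ltn_pmod.
have [k [q [K [e [km Pk em nE]]]]] := off P.
have [k' [q' [K' [e' [km' Pk' em' nE']]]]] := off P'.
case/(window_equivP km Pk em nE km' Pk' em' nE') => -[kk' _] _ _.
apply/eqP; rewrite -(eqn_modDr k) Pk {1}kk' Pk' !modnMr //.
Qed.

Lemma num_classes_residue r N : r < m ->
  num_classes (fun _ => True) (fun q q' => equiv (m * q + r) (m * q' + r)) N ->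
  num_classes (fun P => P %% m = r) (fun P P' => equiv P P') N.
Proof.
move=> rm C; pose f q := m * q + r.
apply/(num_classes_image (A := fun=> True) (f := f)); last exact: C.
- by move=> q _; rewrite /f mulnC modnMDl modn_small.
by move=> P Pr; exists (P %/ m); rewrite // /f mulnC -Pr -divn_eq.
Qed.

Lemma aligned_equivP q q' :
  equiv (m * q + 0) (m * q' + 0) <->
  (0 < n %% m -> t (q + n %/ m) = t (q' + n %/ m)) /\
  perm_eq (window t q (n %/ m)) (window t q' (n %/ m)).
Proof.
have nE : n = 0 + m * (n %/ m) + n %% m by rewrite mulnC -divn_eq.
rewrite (@window_equivP _ 0 q (n %/ m) (n %% m) _ 0 q' (n %/ m) (n %% m)) //;
  rewrite ?addn0 ?ltn_pmod //.
by split=> [[_ [_]]|[? ?]].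
Qed.

(** The run before the first full block only remembers the letter t q of the
    block that contains P, and adding that letter in front of w turns the data
    into those of a window of length K + 1. *)
Lemma shifted_equivP r K e q q' : 0 < r < m -> e < m ->
  n = (m - r) + m * K + e ->
  equiv (m * q + r) (m * q' + r) <->
  [/\ t q = t q', 0 < e -> t (q + K.+1) = t (q' + K.+1)
    & perm_eq (window t q K.+1) (window t q' K.+1)].
Proof.
move=> /andP[r0 rm] em nE; have km : m - r < m by lia.
have Pk j : m * j + r + (m - r) = m * j.+1 by rewrite -addnA subnKC ?mulnSr // ltnW.
rewrite (@window_equivP _ _ _ K e _ _ _ K e km (Pk q) em nE km (Pk q') em nE).
rewrite !thue_morse_block // !addSnnS /window /=.
split=> [[[_ aa'] [_ bb'] ww']|[aa' bb' ww']].
  have {}aa' : t q = t q' by apply: (addIr (r%:R)%R); apply: aa'; rewrite subn_gt0.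
  by split; rewrite // aa' perm_cons.
by split; [rewrite aa'|split|rewrite aa' perm_cons in ww'].
Qed.

Lemma num_classes_aligned_dvd : m %| n ->
  num_classes (fun P => P %% m = 0) (fun P P' => equiv P P')
    (abelian_complexity t (n %/ m)).
Proof.
move=> mn; apply: num_classes_residue => //.
apply: eq_num_classes ((num_classes_window t 1 (n %/ m) _).2 erefl) => q q' _ _.
rewrite aligned_equivP (eqP mn).
by split=> [/binomial_equiv1P|[_ /binomial_equiv1P]].
Qed.

Lemma block_count_ge r K e : r < m -> n = r + m * K + e -> e < m -> m <= K.+1.
Proof. by move: n_large; nia. Qed.

Lemma num_classes_aligned_ndvd : ~~ (m %| n) ->
  num_classes (fun P => P %% m = 0) (fun P P' => equiv P P')
    (m * ('C(m, 2) + 1)).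
Proof.
move=> mn; apply: num_classes_residue => //.
have ml : m <= n %/ m by rewrite leq_divRL // mulnn.
apply: eq_num_classes (num_classes_right_end m_gt1 ml) => q q' _ _.
rewrite aligned_equivP lt0n -/(dvdn m n) mn.
by split=> -[H ww']; split=> //; apply: H.
Qed.

(** The second run is empty exactly when n + r is a multiple of m; then only the
    left end of the window is recorded. *)
Lemma num_classes_shifted r : 0 < r < m ->
  num_classes (fun P => P %% m = r) (fun P P' => equiv P P')
    (if m %| n + r then m * ('C(m, 2) + 1) else m * (m * m.-1 + 1)).
Proof.
move=> rm; have /andP[r0 rltm] := rm.
apply: num_classes_residue => //.
have km : m - r <= n by nia.
pose K := (n - (m - r)) %/ m; pose e := (n - (m - r)) %% m.
have em : e < m by apply: ltn_pmod.
have nE : n = (m - r) + m * K + e by rewrite -addnA mulnC -divn_eq subnKC.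
have ml : m <= K.+1 by apply: block_count_ge nE em; lia.
have eE : (m %| n + r) = (e == 0).
  have -> : n + r = m * K.+1 + e by lia.
  by rewrite dvdn_addr ?dvdn_mulr // /dvdn modn_small.
rewrite eE; have [e0|e0] := eqVneq e 0.
  apply: eq_num_classes (num_classes_left_end m_gt1 ml) => q q' _ _.
  rewrite (shifted_equivP _ _ rm em nE) e0.
  by split=> [[]|[]].
apply: eq_num_classes (num_classes_both_ends m_gt1 ml) => q q' _ _.
rewrite (shifted_equivP _ _ rm em nE) lt0n e0.
by split=> -[aa' bb' ww']; split=> //; apply: bb'.
Qed.

End Fibers.

(** For m not dividing n, two residues record a single end and m - 2 record both;
    b stands for C(m,2). *)
Lemma sum_over_residues m b : 3 <= m -> 2 * b = m * (m - 1) ->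
  2 * (m * (b + 1)) + (m - 2) * (m * (m * m.-1 + 1)) =
  m ^ 4 - 2 * m ^ 3 + 2 * m ^ 2.
Proof.
move=> m3 bE; have le : 2 * m ^ 3 <= m ^ 4.
  by rewrite (expnS m 3) leq_mul2r ltnW ?orbT.
suff : 2 * (m * (b + 1)) + (m - 2) * (m * (m * m.-1 + 1)) + 2 * m ^ 3 =
    m ^ 4 + 2 * m ^ 2 by lia.
have -> : 2 * (m * (b + 1)) = m * (m * (m - 1) + 2) by rewrite -bE; lia.
by case: m m3 {le bE} => [|[|[|k]]] // _; rewrite !subSS !subn0 -pred_Sn; ring.
Qed.

Theorem theorem3 (m n : nat) (hm : 3 <= m) (hn : m ^ 2 <= n) :
  binomial_complexity (thue_morse m) 2 n =
    if m %| n then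
      abelian_complexity (thue_morse m) (n %/ m)
      + m * (m - 1) * (m * (m - 1) + 1)
    else m ^ 4 - 2 * m ^ 3 + 2 * m ^ 2.
Proof.
have m0 : 0 < m by lia.
pose N r := if r == 0 then
    if m %| n then abelian_complexity (thue_morse m) (n %/ m)
    else m * ('C(m, 2) + 1)
  else if m %| n + r then m * ('C(m, 2) + 1) else m * (m * m.-1 + 1).
have -> : binomial_complexity (thue_morse m) 2 n = \sum_(r < m) N r.
  apply/num_classes_window; apply: (num_classes_tag (tag := fun P => P %% m)).
  - by move=> P; rewrite ltn_pmod.
  - by move=> P P'; apply: equiv_same_residue.
  move=> [|r] rm; rewrite /N /=; last exact: num_classes_shifted.
  by case: ifP => mn; [apply: num_classes_aligned_dvd|
    apply: num_classes_aligned_ndvd; rewrite ?mn].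
pose o := Ordinal m0.
case: ifP => mn.
  rewrite (bigD1 o) //= {1}/N /= mn; congr (_ + _).
  rewrite (eq_bigr (fun=> m * (m * m.-1 + 1))) => [|r r0].
    by rewrite sum_nat_const cardC1 card_ord subn1; lia.
  rewrite /N; have /negPf-> : nat_of_ord r != 0 by [].
  by rewrite dvdn_addr // gtnNdvd // lt0n.
have r1m : m - n %% m < m by rewrite ltn_subrL m0 lt0n -/(dvdn m n) mn.
pose o1 := Ordinal r1m.
have nm : n %% m < m by rewrite ltn_pmod.
have dvE (r : 'I_m) : r != o -> (m %| n + r) = (r == o1).
  rewrite -!val_eqE /= => r0; have rm := ltn_ord r.
  rewrite /dvdn -modnDml; have [lt|ge] := ltnP (n %% m + r) m.
    by rewrite modn_small //; lia.
  have -> : n %% m + r = (n %% m + r - m) + m by lia.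
  by rewrite modnDr modn_small; lia.
have r0E (r : 'I_m) : (nat_of_ord r == 0) = (r == o) by [].
rewrite (bigID (pred2 o o1)) /=.
rewrite (eq_bigr (fun=> m * ('C(m, 2) + 1))) => [|r]; last first.
  rewrite /N r0E; have [_|ro] := eqVneq r o; first by rewrite mn.
  by move=> /= ro1; rewrite dvE // ro1.
rewrite [X in _ + X](eq_bigr (fun=> m * (m * m.-1 + 1))) => [|r]; last first.
  by case/norP=> ro ro1; rewrite /N r0E (negPf ro) dvE // (negPf ro1).
rewrite !sum_nat_const card2.
have oo1 : o != o1 by rewrite -val_eqE /=; lia.
rewrite oo1 (_ : #|_| = m - 2); last first.
  have := cardC (pred2 o o1); rewrite card2 oo1 card_ord.
  rewrite (eq_card (B := [pred i | ~~ pred2 o o1 i])) //.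
  by move: (#|_|) => c cE; move: (m) cE => ? <-; rewrite addKn.
apply: sum_over_residues => //.
by rewrite -mul_bin_diag bin1 subn1.
Qed.
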